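(* Let $(\mathbb{B},\|\cdot\|)$ be a separable $\beta$-smooth Banach space and let $(X_n)_{n\ge1}$ be $\mathbb{B}$-valued random variables adapted to a filtration $(\mathcal{F}_n)_{n\ge0}$ such that $\mathbb{E}(X_n\mid\mathcal{F}_{n-1})=\mu$ for all $n\ge1$ (some unknown $\mu\in\mathbb{B}$) and $\sup_{n\ge1}\mathbb{E}(\|X_n\|^p\mid\mathcal{F}_{n-1})\le v<\infty$ for known $p\in(1,2]$ and $v>0$. For $\lambda>0$ let $\widehat{\mu}_n(0,\lambda,0):=\frac1n\sum_{m\le n}\mathtt{Trunc}(\lambda X_m)X_m$. Fix $\delta\in(0,1]$. Then for any $\lambda>0$, with probability at least $1-\delta$, simultaneously for all $n\ge1$, \[ \|\widehat{\mu}_n(0,\lambda,0)-\mu\|\le2v\lambda^{p-1}\big(\beta\mathfrak{C}_p(\mathbb{B})+K_p2^{p-1}\big)+\frac{\beta\log(2/\delta)}{\lambda n}. \] Moreover, for a fixed sample size $n$, if \[ \lambda=\left(\frac{\log(2/\delta)\beta}{2nv(\beta\mathfrak{C}_p(\mathbb{B})+K_p2^{p-1})}\right)^{1/p}, \] then with probability at least $1-\delta$, \[ \|\widehat{\mu}_n(0,\lambda,0)-\mu\|\le2\big(2v(\beta\mathfrak{C}_p(\mathbb{B})+K_p2^{p-1})\big)^{1/p}\left(\beta\frac{\log(2/\delta)}{n}\right)^{(p-1)/p}. \]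
   Context: $\beta$-smooth: the norm $f=\|\cdot\|$ satisfies $f(0)=0$, $|f(x+y)-f(x)|\le\|y\|$ and $f^2(x+y)+f^2(x-y)\le2f^2(x)+2\beta^2\|y\|^2$ for all $x,y$. $\mathtt{Trunc}(x):=\min\{1,1/\|x\|\}$ ($\mathtt{Trunc}(0)=1$). $K_p:=\frac1p\left(\frac{p-1}{p}\right)^{p-1}$. $\mathfrak{C}_p(\mathbb{B}):=2^{p-1}\frac{e^{2/\beta}-2/\beta-1}{(2/\beta)^2}$ if $\mathbb{B}$ is a Hilbert space and $\mathfrak{C}_p(\mathbb{B}):=2^{p+1}\frac{e^{2/\beta}-2/\beta-1}{(2/\beta)^2}$ otherwise. *)

(* Defs.v *)
From HB Require Import structures.
From mathcomp Require Import all_boot all_order all_algebra.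
From mathcomp Require Import all_classical all_reals all_analysis.
Set Implicit Arguments. Unset Strict Implicit. Unset Printing Implicit Defensive.
Import Order.TTheory GRing.Theory Num.Theory.
Import numFieldNormedType.Exports.
Local Open Scope classical_set_scope.
Local Open Scope ring_scope.

Definition separable {R : realType} (B : normedModType R) : Prop :=
  exists D : set B, countable D /\ closure D = setT.

Definition beta_smooth {R : realType} (B : normedModType R) (beta : R) : Prop :=
  (forall x y : B, `| `|x + y| - `|x| | <= `|y|) /\
  (forall x y : B, `|x + y| ^+ 2 + `|x - y| ^+ 2 <= 2 * `|x| ^+ 2 + 2 * beta ^+ 2 * `|y| ^+ 2).

Definition is_hilbert {R : realType} (B : normedModType R) : Prop :=
  exists ip : B -> B -> R,
    (forall a x y z, ip (a *: x + y) z = a * ip x z + ip y z) /\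
    (forall x y, ip x y = ip y x) /\
    (forall x, `|x| ^+ 2 = ip x x).

Definition cont_lin_functional {R : realType} (B : normedModType R) (phi : B -> R) : Prop :=
  (forall (a : R) (x y : B), phi (a *: x + y) = a * phi x + phi y) /\ continuous phi.

Definition Trunc {R : realType} {B : normedModType R} (x : B) : R :=
  if x == 0 then 1 else Num.min 1 (`|x|^-1).

Definition Kp {R : realType} (p : R) : R := p^-1 * ((p - 1) / p) `^ (p - 1).

Definition Cp {R : realType} (B : normedModType R) (beta p : R) : R :=
  (if `[< is_hilbert B >] then 2 `^ (p - 1) else 2 `^ (p + 1)) *
  ((expR (2 / beta) - 2 / beta - 1) / (2 / beta) ^+ 2).

Definition filtration {d} {T : measurableType d} (F : nat -> set (set T)) : Prop :=
  (forall n, sigma_algebra setT (F n)) /\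
  (forall n, F n `<=` measurable) /\
  (forall n m, (n <= m)%N -> F n `<=` F m).

(* X_n is F_n-measurable for the Borel sigma-algebra of B (n >= 1) *)
Definition adapted {d} {T : measurableType d} {R : realType} {B : normedModType R}
  (F : nat -> set (set T)) (X : nat -> T -> B) : Prop :=
  forall n, (1 <= n)%N -> forall U : set B, open U -> F n (X n @^-1` U).

Definition mu_hat {T : Type} {R : realType} {B : normedModType R}
  (X : nat -> T -> B) (lam : R) (n : nat) (w : T) : B :=
  (n%:R)^-1 *: \sum_(1 <= m < n.+1) (Trunc (lam *: X m w) *: X m w).

(* Main.v *)
Require Import Defs.
From HB Require Import structures.
From mathcomp Require Import all_boot all_order all_algebra.
From mathcomp Require Import all_classical all_reals all_analysis.
From mathcomp Require Import measurable_realfun ring lra.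
Import Order.TTheory GRing.Theory Num.Theory.
Import numFieldNormedType.Exports.
Set Implicit Arguments. Unset Strict Implicit. Unset Printing Implicit Defensive.
Local Open Scope classical_set_scope.
Local Open Scope ring_scope.

(** By homogeneity take [lam = 1]; let [S_n] be the sum of the steps
    [(truncate X_m - mu) / beta], where [truncate x = Trunc x *: x] has norm at
    most [1].  In a [beta]-smooth space every point [s] carries a continuous
    linear functional [l] with [l s = |s|] and [l <= |.|], and it satisfies
      [cosh |s + y| <=
       cosh |s| + sinh |s| l(y) + beta^2 |y|^2 exp_rem(M) cosh |s|]
    for [|y| <= M], with [exp_rem(x) = (e^x - x - 1) / x^2].  Used at
    [s - mu / beta], this bounds [cosh |s + (truncate X - mu) / beta|] by
    [cosh |s|], plus a multiple of [l (X - mu)], plus a multiple of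
    [|X|^p cosh |s|].  The second term integrates to zero over past events, so
    that no vector-valued integral is needed, and [cosh |S_n| / rate^n] is a
    supermartingale for a suitable constant [rate]; Ville's inequality concludes.
    The shift by [mu / beta] costs a factor [e^(|mu| / beta)], which is affordable
    up to [2]; beyond that, since [|mu|^p <= v], the claimed bound exceeds the
    trivial one, [1 + |mu|]. *)

(** * Exponential inequalities *)

Section exponential.
Variable R : realType.
Implicit Types (c e x y M : R) (n : nat).

Lemma series_exp_coeff_le n x : 0 <= x -> series (exp_coeff x) n <= expR x.
Proof.
move=> x0; apply: nondecreasing_cvgn_le; last exact: is_cvg_series_exp_coeff.
by apply/nondecreasing_seqP => m; rewrite seriesSr lerDl exp_coeff_ge0.
Qed.

Lemma expR_remainder_le n x M : 0 <= x <= M ->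
  (expR x - series (exp_coeff x) n) * M ^+ n <=
  (expR M - series (exp_coeff M) n) * x ^+ n.
Proof.
move=> /andP[x0 xM]; have M0 := le_trans x0 xM.
have cvg_rem y z :
    (series (exp_coeff y) m - series (exp_coeff y) n) * z @[m --> \oo] -->
    (expR y - series (exp_coeff y) n) * z.
  apply: cvgM; last exact: cvg_cst.
  by apply: cvgB; [exact: is_cvg_series_exp_coeff|exact: cvg_cst].
apply: (ler_cvg_to (cvg_rem x _) (cvg_rem M _)); exists n => //= m /= nm.
rewrite !sub_series_geq// !mulr_suml !big_seq; apply: ler_sum => i.
rewrite mem_index_iota => /andP[/subnK <- _]; rewrite /exp_coeff/=.
rewrite !exprD mulrAC [leRHS]mulrAC ler_wpM2r ?invr_ge0//.
rewrite -!mulrA [M ^+ n * _]mulrC ler_wpM2r ?lerXn2r//.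
by rewrite mulr_ge0 ?exprn_ge0.
Qed.

Definition exp_rem x : R := (expR x - x - 1) / x ^+ 2.

Lemma expR_le_exp_rem x M : 0 <= x <= M ->
  expR x - x - 1 <= x ^+ 2 * exp_rem M.
Proof.
move=> /andP[x0 xM]; have [M0|M0] := eqVneq M 0.
  have -> : x = 0 by apply/eqP; rewrite eq_le x0 -M0 xM.
  by rewrite expR0 expr0n/= mul0r; lra.
have series2 y : series (exp_coeff y) 2 = y + 1.
  rewrite /series/= !big_nat_recl// big_geq// /exp_coeff/=.
  by rewrite expr0 expr1 !divr1 addr0 addrC.
have := @expR_remainder_le 2 x M; rewrite x0 xM => /(_ isT).
rewrite !series2 !opprD !addrA /exp_rem mulrA ler_pdivlMr 1?[x ^+ 2 * _]mulrC//.
by rewrite exprn_even_gt0.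
Qed.

Lemma exp_rem_le x M : 0 < x <= M -> exp_rem x <= exp_rem M.
Proof.
move=> /andP[x0 xM]; rewrite {1}/exp_rem ler_pdivrMr ?exprn_gt0// mulrC.
by rewrite expR_le_exp_rem// (ltW x0).
Qed.

Let expR_ge_Taylor4 x : 0 <= x ->
  1 + x + x ^+ 2 / 2 + x ^+ 3 / 6 + x ^+ 4 / 24 <= expR x.
Proof.
move=> /(series_exp_coeff_le 5); apply: le_trans.
rewrite /series/= !big_nat_recl// big_geq// /exp_coeff/= /factorial/=.
by rewrite expr0 expr1 !divr1 addr0 !addrA.
Qed.

Lemma exp_rem_ge_half x : 0 < x -> 2^-1 <= exp_rem x.
Proof.
move=> x0; rewrite /exp_rem ler_pdivlMr ?exprn_gt0//.
have := expR_ge_Taylor4 (ltW x0).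
have := exprn_gt0 3 x0; have := exprn_gt0 4 x0; lra.
Qed.

Lemma exp_rem_gt0 x : 0 < x -> 0 < exp_rem x.
Proof. by move=> /exp_rem_ge_half; apply: lt_le_trans. Qed.

Lemma exp_rem_ge_div2 x : 0 < x <= 2 -> x / 2 <= exp_rem x.
Proof.
move=> /andP[x0 x2]; rewrite /exp_rem ler_pdivlMr ?exprn_gt0//.
have := expR_ge_Taylor4 (ltW x0).
have : 0 <= x ^+ 2 * ((2 - x) * (6 - x)).
  by rewrite mulr_ge0 ?sqr_ge0// mulr_ge0//; lra.
lra.
Qed.

Lemma expR1_le3 : expR 1 <= 3 :> R.
Proof.
have inv_ge : (7 / 8) ^+ 8 <= expR (- 1) :> R.
  have -> : expR (- 1) = expR (- 8^-1) ^+ 8 :> R.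
    by rewrite -expRM_natl; congr expR; lra.
  rewrite lerXn2r ?nnegrE ?expR_ge0 ?divr_ge0//.
  by have := @expR_ge1Dx R (- 8^-1); lra.
rewrite -[leLHS]invrK -expRN invf_ple ?posrE ?expR_gt0//.
by apply: le_trans inv_ge; lra.
Qed.

Lemma expR_le_quadratic x : 0 <= x <= 1 -> expR x <= 1 + x + x ^+ 2.
Proof.
move=> /expR_le_exp_rem; have := sqr_ge0 x; have := expR1_le3.
rewrite /exp_rem expr1n divr1; nra.
Qed.

Definition coshR x : R := (expR x + expR (- x)) / 2.
Definition sinhR x : R := (expR x - expR (- x)) / 2.

Lemma coshR0 : coshR 0 = 1.
Proof. by rewrite /coshR oppr0 expR0; lra. Qed.

Lemma sinhR0 : sinhR 0 = 0.
Proof. by rewrite /sinhR oppr0 subrr mul0r. Qed.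

Lemma coshR_ge1 x : 1 <= coshR x.
Proof. by rewrite /coshR; have := expR_ge1Dx x; have := expR_ge1Dx (- x); lra. Qed.

Lemma coshR_gt0 x : 0 < coshR x.
Proof. exact: lt_le_trans ltr01 (coshR_ge1 x). Qed.

Lemma sinhR_ge0 x : 0 <= x -> 0 <= sinhR x.
Proof. by move=> x0; rewrite /sinhR divr_ge0// subr_ge0 ler_expR; lra. Qed.

Lemma sinhR_le_coshR x : sinhR x <= coshR x.
Proof. by rewrite /sinhR /coshR; have := expR_ge0 (- x); lra. Qed.

Lemma expR_le_coshR x : expR x <= 2 * coshR x.
Proof. by rewrite /coshR; have := expR_ge0 (- x); lra. Qed.

Lemma coshRD x y : coshR (x + y) = coshR x * coshR y + sinhR x * sinhR y.
Proof. by rewrite /coshR /sinhR opprD !expRD; field. Qed.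

Lemma coshR_tangent c x : coshR c + sinhR c * (x - c) <= coshR x.
Proof.
have expR_tangent (a b : R) : expR a * (1 + (b - a)) <= expR b.
  by rewrite -[in leRHS](subrKC a b) expRD ler_wpM2l ?expR_ge0 ?expR_ge1Dx.
have := expR_tangent c x; have := expR_tangent (- c) (- x).
by rewrite /coshR /sinhR; lra.
Qed.

Lemma coshR_le x y : 0 <= x <= y -> coshR x <= coshR y.
Proof.
move=> /andP[x0 xy]; apply: le_trans (coshR_tangent x y).
by rewrite lerDl mulr_ge0 ?sinhR_ge0// subr_ge0.
Qed.

Lemma coshRD_le_expR x e : 0 <= e -> coshR (x + e) <= expR e * coshR x.
Proof.
move=> e0; have : expR (- x) * expR (- e) <= expR (- x) * expR e.
  by rewrite ler_wpM2l ?expR_ge0// ler_expR; lra.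
by rewrite /coshR opprD !expRD; lra.
Qed.

Lemma sinhR_bounds x : 0 <= x -> x <= sinhR x <= x * coshR x.
Proof.
rewrite le_eqVlt => /predU1P[<-|x0]; first by rewrite sinhR0 mul0r lexx.
have sinhR' y : is_derive y 1 sinhR (coshR y).
  by rewrite /sinhR; apply: is_derive_eq; rewrite /GRing.scale/= /coshR; lra.
have [|y /itvP y0x] := MVT x0 (fun y _ => sinhR' y).
  by apply: derivable_within_continuous => y _; exact: ex_derive.
rewrite sinhR0 !subr0 mulrC => ->.
by rewrite ler_peMr ?coshR_ge1 ?(ltW x0)// ler_wpM2l ?coshR_le ?y0x// ltW.
Qed.

Lemma coshRD_le c x M : 0 <= c -> `|x| <= M ->
  coshR (c + x) <= coshR c + sinhR c * x + coshR c * x ^+ 2 * exp_rem M.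
Proof.
move=> c0 xM.
have rem : expR `|x| - `|x| - 1 <= x ^+ 2 * exp_rem M.
  by rewrite -(@real_normK _ x) ?num_real// expR_le_exp_rem// normr_ge0.
have even : coshR x = coshR `|x|.
  by case: ger0P => // _; rewrite /coshR opprK addrC.
have odd : sinhR x - x <= sinhR `|x| - `|x|.
  have /andP[+ _] := sinhR_bounds (normr_ge0 x).
  by case: ger0P => // _; rewrite /sinhR opprK; lra.
have odd0 : 0 <= sinhR `|x| - `|x|.
  by rewrite subr_ge0; have /andP[] := sinhR_bounds (normr_ge0 x).
have {}odd := le_trans (ler_wpM2l (sinhR_ge0 c0) odd)
  (ler_wpM2r odd0 (sinhR_le_coshR c)).
have {}rem := ler_wpM2l (ltW (coshR_gt0 c)) rem.
have exp_split : expR `|x| = coshR `|x| + sinhR `|x| by rewrite /coshR /sinhR; lra.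
by rewrite coshRD even; rewrite exp_split in rem; lra.
Qed.

End exponential.

(** * Support functionals of a smooth norm *)

Section cont_lin_functional.
Variables (R : realType) (B : normedModType R) (phi : B -> R).
Hypothesis lin_phi : cont_lin_functional phi.
Implicit Types (x y : B) (a : R).

Lemma cont_lin0 : phi 0 = 0.
Proof. by have := lin_phi.1 (-1) 0 0; rewrite scaler0 addr0; lra. Qed.

Lemma cont_linZ a x : phi (a *: x) = a * phi x.
Proof. by rewrite -[a *: x]addr0 lin_phi.1 cont_lin0 addr0. Qed.

Lemma cont_linB x y : phi (x - y) = phi x - phi y.
Proof. by rewrite addrC -scaleN1r lin_phi.1 mulN1r addrC. Qed.

Lemma cont_lin_scale a : cont_lin_functional (fun x => a * phi x).
Proof.
split=> [b x y|x]; first by rewrite lin_phi.1; ring.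
by apply: cvgM; [exact: cvg_cst|exact: lin_phi.2].
Qed.

Lemma cont_lin_bounded : exists2 K, 0 <= K & forall x, `|phi x| <= K * `|x|.
Proof.
pose f : {linear B -> R^o} :=
  HB.pack phi (GRing.isLinear.Build R B R^o _ phi lin_phi.1).
have /linear_boundedP/pinfty_ex_gt0[K K0 phiK] : bounded_near f (nbhs 0).
  exact/linear_bounded_continuous/lin_phi.2.
by exists K => //; exact: ltW.
Qed.

End cont_lin_functional.

Section norm_deriv.
Variables (R : realType) (B : normedModType R) (s : B).
Implicit Types (y z : B) (t u a : R).

(* The right derivative [inf_(h > 0) (|s + h y| - |s|) / h] of the norm at [s],
   with [t = h^-1]. *)
Definition norm_deriv y : R :=
  inf [set `|t *: s + y| - t * `|s| | t in [set t : R | 0 < t]].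

Let norm_quot_ge y t : 0 < t -> - `|y| <= `|t *: s + y| - t * `|s|.
Proof.
move=> t0; have := lerB_normD (t *: s) y.
by rewrite normrZ gtr0_norm//; lra.
Qed.

Lemma norm_deriv_le y t : 0 < t -> norm_deriv y <= `|t *: s + y| - t * `|s|.
Proof.
move=> t0; apply: ge_inf; last by exists t.
by exists (- `|y|) => _ [u /= u0 <-]; exact: norm_quot_ge.
Qed.

Lemma le_norm_deriv y a :
  (forall t, 0 < t -> a <= `|t *: s + y| - t * `|s|) -> a <= norm_deriv y.
Proof.
move=> ay; apply: lb_le_inf.
  by exists (`|1 *: s + y| - 1 * `|s|); exists 1 => /=.
by move=> _ [t /= t0 <-]; exact: ay.
Qed.

Lemma norm_deriv_le_norm y : norm_deriv y <= `|y|.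
Proof.
apply: le_trans (norm_deriv_le y ltr01) _.
by have := ler_normD (1 *: s) y; rewrite scale1r; lra.
Qed.

Lemma norm_deriv_self : norm_deriv s = `|s|.
Proof.
apply/eqP; rewrite eq_le norm_deriv_le_norm/=; apply: le_norm_deriv => t t0.
rewrite -[X in `|_ + X|]scale1r -scalerDl normrZ ger0_norm; first lra.
by rewrite addr_ge0 ?ltW.
Qed.

Lemma norm_derivD_le y z : norm_deriv (y + z) <= norm_deriv y + norm_deriv z.
Proof.
rewrite -lerBlDl; apply: le_norm_deriv => t t0; rewrite lerBlDl -lerBlDr.
apply: le_norm_deriv => u u0; rewrite lerBlDr.
apply: le_trans (norm_deriv_le _ (addr_gt0 u0 t0)) _.
have := ler_normD (u *: s + y) (t *: s + z).
by rewrite addrACA -scalerDl; lra.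
Qed.

Lemma norm_derivZ a y : 0 < a -> norm_deriv (a *: y) = a * norm_deriv y.
Proof.
have ge b z : 0 < b -> b * norm_deriv z <= norm_deriv (b *: z).
  move=> b0; apply: le_norm_deriv => t t0.
  have := norm_deriv_le z (divr_gt0 t0 b0); rewrite -(ler_pM2l b0).
  have -> : t *: s + b *: z = b *: ((t / b) *: s + z).
    by rewrite scalerDr scalerA mulrCA divff ?mulr1 ?gt_eqF.
  rewrite normrZ gtr0_norm// mulrBr mulrA [b * (t / b)]mulrCA.
  by rewrite divff ?mulr1// gt_eqF.
move=> a0; apply/eqP; rewrite eq_le ge// andbT.
have := ge a^-1 (a *: y); rewrite invr_gt0 scalerK ?gt_eqF// => /(_ a0).
by rewrite ler_pdivrMl.
Qed.

End norm_deriv.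

Section support_functional.
Variables (R : realType) (B : normedModType R).
Implicit Types (s y : B) (l : B -> R).

Definition support_functional s l :=
  [/\ cont_lin_functional l, l s = `|s| & forall y, l y <= `|y|].

Lemma support_functional_subgradient s l y : support_functional s l ->
  l y <= `|s + y| - `|s|.
Proof.
move=> [lin ls le]; have := le (1 *: s + y).
by rewrite lin.1 ls mul1r scale1r; lra.
Qed.

End support_functional.

Section smooth_norm.
Variables (R : realType) (B : normedModType R) (beta : R).
Hypothesis smooth : beta_smooth B beta.
Implicit Types (s x y z : B) (l : B -> R) (a : R).

Lemma beta_smooth_ge1 x : 0 <= beta -> x != 0 -> 1 <= beta.
Proof.
move=> b0; rewrite -normr_gt0 => x0; have := smooth.2 0 x.
rewrite add0r sub0r normrN normr0 expr0n mulr0 add0r => sqr_le.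
rewrite -(@ler_pXn2r _ 2)// ?nnegrE// expr1n -(ler_pM2r (exprn_gt0 2 x0)).
lra.
Qed.

Let norm_derivN s y : s != 0 -> norm_deriv s (- y) = - norm_deriv s y.
Proof.
rewrite -normr_gt0 => s0; apply/eqP; rewrite eq_le; apply/andP; split; last first.
  have := norm_derivD_le s 0 0; have := norm_derivD_le s y (- y).
  by rewrite subrr addr0; lra.
rewrite -subr_le0 opprK; set sum := _ + _.
have bound t : 0 < t -> t * `|s| * sum <= beta ^+ 2 * `|y| ^+ 2.
  move=> t0; have := ler_wpM2l (ltW (mulr_gt0 t0 s0))
    (lerD (norm_deriv_le s (- y) t0) (norm_deriv_le s y t0)).
  have := smooth.2 (t *: s) y; rewrite normrZ gtr0_norm// -/sum.
  have := sqr_ge0 (`|t *: s + y| - t * `|s|).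
  by have := sqr_ge0 (`|t *: s - y| - t * `|s|); lra.
rewrite leNgt; apply/negP => sum0.
have K0 : 0 < beta ^+ 2 * `|y| ^+ 2 + 1 by rewrite ltr_wpDl// mulr_ge0 ?sqr_ge0.
have := bound _ (divr_gt0 K0 (mulr_gt0 s0 sum0)).
by rewrite -mulrA divfK ?gt_eqF ?mulr_gt0// gerDl ler10.
Qed.

Let norm_deriv_linear s a y z : s != 0 ->
  norm_deriv s (a *: y + z) = a * norm_deriv s y + norm_deriv s z.
Proof.
move=> s0; have derivD u v : norm_deriv s (u + v) = norm_deriv s u + norm_deriv s v.
  apply/eqP; rewrite eq_le norm_derivD_le/=.
  have := norm_derivD_le s (- u) (- v).
  by rewrite -opprD !norm_derivN//; lra.
rewrite derivD; congr (_ + _); case: (ltgtP a 0) => [a0|a0|->].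
- have -> : a *: y = - (- a *: y) by rewrite scaleNr opprK.
  by rewrite norm_derivN// norm_derivZ ?oppr_gt0// mulNr opprK.
- exact: norm_derivZ.
- by rewrite scale0r mul0r; have := derivD 0 0; rewrite addr0; lra.
Qed.

Lemma exists_support_functional s : exists l, support_functional s l.
Proof.
have [->|s0] := eqVneq s 0.
  exists (fun=> 0); split => [|//|//]; last by rewrite normr0.
  by split=> [a x y|x]; [rewrite mulr0 addr0|exact: cvg_cst].
exists (norm_deriv s); split; [split=> [a x y|x]|exact: norm_deriv_self|].
- exact: norm_deriv_linear.
- have sub u v : norm_deriv s u - norm_deriv s v <= `|u - v|.
    apply: le_trans (norm_deriv_le_norm s _).
    by rewrite [u - v]addrC -(scaleN1r v) norm_deriv_linear// mulN1r addrC.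
  apply/cvgrPdist_lt => e e0; near=> z.
  apply: (@le_lt_trans _ _ `|x - z|); last by near: z; exact: cvgr_dist_lt.
  by rewrite ler_norml sub lerNl opprB distrC sub.
- exact: norm_deriv_le_norm.
Unshelve. all: by end_near. Qed.

Lemma norm_sqr_support_le s l y : support_functional s l ->
  `|s + y| ^+ 2 <= `|s| ^+ 2 + 2 * `|s| * l y + 2 * beta ^+ 2 * `|y| ^+ 2.
Proof.
move=> [lin ls le]; have := smooth.2 s y.
have := ler_wpM2l (normr_ge0 s) (le (s - y)); rewrite (cont_linB lin) ls.
by have := sqr_ge0 (`|s| - `|s - y|); lra.
Qed.

(* Bisecting the increment replaces the error term [c `|y| ^+ 2] by
   [(c + beta ^+ 2) / 2 * `|y| ^+ 2], whose iterates tend to [beta ^+ 2]. *)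
Lemma norm_sqr_smooth s l y : support_functional s l ->
  `|s + y| ^+ 2 <= `|s| ^+ 2 + 2 * `|s| * l y + beta ^+ 2 * `|y| ^+ 2.
Proof.
move=> sl; have [lin _ _] := sl.
have bisect k : forall z, `|s + z| ^+ 2 <=
    `|s| ^+ 2 + 2 * `|s| * l z + (1 + 2^-1 ^+ k) * (beta ^+ 2 * `|z| ^+ 2).
  elim: k => [z|k IH z].
    by rewrite expr0 mulrA; exact: norm_sqr_support_le.
  have := smooth.2 (s + 2^-1 *: z) (2^-1 *: z); have := IH (2^-1 *: z).
  rewrite addrK -[s + _ + _]addrA -scalerDl.
  rewrite (_ : 2^-1 + 2^-1 = 1) ?scale1r; last lra.
  rewrite [2^-1 ^+ k.+1]exprS (cont_linZ lin) normrZ ger0_norm// exprMn.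
  lra.
have cvg_bound : `|s| ^+ 2 + 2 * `|s| * l y +
    (1 + 2^-1 ^+ k) * (beta ^+ 2 * `|y| ^+ 2) @[k --> \oo] -->
    `|s| ^+ 2 + 2 * `|s| * l y + (1 + 0) * (beta ^+ 2 * `|y| ^+ 2).
  apply: cvgD; first exact: cvg_cst.
  apply: cvgM; last exact: cvg_cst.
  apply: cvgD; first exact: cvg_cst.
  by apply: cvg_expr; rewrite ger0_norm// invf_lt1// ltr1n.
rewrite addr0 mul1r in cvg_bound.
by apply: (ler_cvg_to (cvg_cst _) cvg_bound); near=> k; exact: bisect.
Unshelve. all: by end_near. Qed.

End smooth_norm.

Section coshR_norm.
Variables (R : realType) (B : normedModType R).
Implicit Types (s x y : B) (l : B -> R) (a b r Q M e beta : R).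

Lemma coshR_norm_le x y e : `|x - y| <= e -> coshR `|x| <= expR e * coshR `|y|.
Proof.
move=> xye; have e0 := le_trans (normr_ge0 _) xye.
apply: le_trans (coshRD_le_expR _ e0); apply: coshR_le; rewrite normr_ge0/=.
by have := ler_normD (x - y) y; rewrite subrK; lra.
Qed.

Let coshR_le_of_sqr a r b Q M : 0 <= a -> 0 < M -> `|b - a| <= M ->
  r <= b - a -> b ^+ 2 <= a ^+ 2 + 2 * a * r + Q ->
  coshR b <= coshR a + sinhR a * r + coshR a * Q * exp_rem M.
Proof.
move=> a0 M0 ba_le r_le sqr_le; have := coshRD_le a0 ba_le.
rewrite subrKC => /le_trans; apply.
have f0 := exp_rem_ge_half M0; have C0 := coshR_gt0 a.
have /andP[_ sinh_le] := sinhR_bounds a0.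
have slack : 0 <= b - a - r by lra.
have sinh_slack : sinhR a * (b - a - r) <=
    coshR a * exp_rem M * (2 * a * (b - a - r)).
  rewrite mulrA ler_wpM2r//; apply: le_trans sinh_le _.
  by have := mulr_ge0 a0 (ltW C0); nra.
have : coshR a * exp_rem M * ((b - a) ^+ 2 + 2 * a * (b - a - r)) <=
    coshR a * exp_rem M * Q.
  by rewrite ler_wpM2l//; [exact: mulr_ge0 (ltW C0) (ltW (exp_rem_gt0 M0))|lra].
lra.
Qed.

Lemma coshR_norm_smooth beta s l y M : beta_smooth B beta ->
  support_functional s l -> 0 < M -> `|y| <= M ->
  coshR `|s + y| <= coshR `|s| + sinhR `|s| * l y
    + coshR `|s| * (beta ^+ 2 * `|y| ^+ 2) * exp_rem M.
Proof.
move=> smooth sl M0 yM; apply: coshR_le_of_sqr => //.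
- by apply: le_trans (ler_dist_dist _ _) _; rewrite addrAC subrr add0r.
- exact: support_functional_subgradient.
- exact: norm_sqr_smooth.
Qed.

Lemma coshR_norm_subgradient s l y : support_functional s l ->
  coshR `|s| + sinhR `|s| * l y <= coshR `|s + y|.
Proof.
move=> sl; apply: le_trans (coshR_tangent `|s| `|s + y|).
by rewrite lerD2l ler_wpM2l ?sinhR_ge0 ?support_functional_subgradient.
Qed.

End coshR_norm.

(** * Truncation *)

Section power_inequalities.
Variables (R : realType) (p : R).
Hypothesis p1 : 1 < p.
Implicit Types x b z : R.

Let p0 : 0 < p. Proof. exact: lt_trans p1. Qed.

Lemma powR_young_tangent x b : 0 <= x -> 0 <= b ->
  p * b `^ (p - 1) * x <= x `^ p + (p - 1) * b `^ p.
Proof.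
move=> x0 b0; have q0 : 0 < 1 - p^-1 by rewrite subr_gt0 invf_lt1.
have := @conjugate_powR R x (b `^ (p - 1)) p (1 - p^-1)^-1 x0 (powR_ge0 _ _) p0.
rewrite invr_gt0 invrK => /(_ q0) /(_ ltac:(ring)).
rewrite -powRrM (_ : (p - 1) / (1 - p^-1) = p); last first.
  by field; rewrite !gt_eqF//= subr_gt0.
rewrite -(ler_pM2l p0) => young.
have -> : x `^ p + (p - 1) * b `^ p =
    p * (x `^ p / p + b `^ p * (1 - p^-1)) by field; rewrite gt_eqF.
by rewrite mulrAC -mulrA.
Qed.

Lemma Kp_gt0 : 0 < Kp p.
Proof. by rewrite mulr_gt0 ?invr_gt0// powR_gt0// divr_gt0// subr_gt0. Qed.

(* [Kp p] is the constant making [z - 1] tangent to [Kp p * z `^ p], at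
   [z = p / (p - 1)]. *)
Lemma sub1_le_Kp z : 0 <= z -> z - 1 <= Kp p * z `^ p.
Proof.
move=> z0; have pm0 : 0 < p - 1 by rewrite subr_gt0.
pose q := p / (p - 1); have q0 : 0 < q by rewrite divr_gt0.
have Kp_inv : Kp p * (p * q `^ (p - 1)) = 1.
  rewrite /Kp mulrAC mulrA mulVf ?gt_eqF// mul1r.
  rewrite -powRM ?divr_ge0 ?(ltW p0) ?(ltW pm0)//.
  by rewrite /q mulrA divfK ?gt_eqF// divff ?gt_eqF// powR1.
have := ler_wpM2l (ltW Kp_gt0) (powR_young_tangent z0 (ltW q0)).
rewrite -(mulr_powRB1 (ltW q0) p0).
have -> : (p - 1) * (q * q `^ (p - 1)) = p * q `^ (p - 1).
  by rewrite mulrA; congr (_ * _); rewrite mulrC divfK ?gt_eqF.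
by rewrite mulrDr mulrA Kp_inv mul1r; lra.
Qed.

Lemma powR2_Kp_ge1 : 1 <= 2 `^ p * Kp p.
Proof. by have := sub1_le_Kp (ler0n R 2); lra. Qed.

Lemma sqr_le_powR z : p <= 2 -> 0 <= z <= 1 -> z ^+ 2 <= z `^ p.
Proof.
move=> p2 /andP[+ z1]; rewrite le_eqVlt => /predU1P[<-|z0].
  by rewrite powR0 ?expr0n//= gt_eqF.
by rewrite -powR_mulrn ?(ltW z0)// ger_powR// z0.
Qed.

End power_inequalities.

Section truncation.
Variables (R : realType) (B : normedModType R).
Implicit Types (x : B) (p : R).

Definition truncate x : B := Trunc x *: x.

Let TruncE x : Trunc x = (Num.max 1 `|x|)^-1.
Proof.
rewrite /Trunc; have [->|x0] := eqVneq x 0.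
  by rewrite normr0 max_l// invr1.
have {}x0 : 0 < `|x| by rewrite normr_gt0.
have [x1|x1] := leP `|x| 1; first by rewrite invr1 min_l// invf_ge1.
by rewrite min_r// invf_le1// ltW.
Qed.

Lemma norm_truncate x : `|truncate x| = Num.min 1 `|x|.
Proof.
rewrite /truncate TruncE normrZ gtr0_norm ?invr_gt0 ?lt_max ?ltr01//.
have [x1|x1] := leP `|x| 1; first by rewrite invr1 mul1r.
by rewrite mulVf// gt_eqF// (lt_trans ltr01).
Qed.

Lemma norm_truncate_le1 x : `|truncate x| <= 1.
Proof. by rewrite norm_truncate ge_min lexx. Qed.

Lemma norm_sub_truncate x : `|x - truncate x| = Num.max 0 (`|x| - 1).
Proof.
rewrite /truncate TruncE -[X in X - _]scale1r -scalerBl normrZ.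
have [x1|x1] := leP `|x| 1.
  by rewrite invr1 subrr normr0 mul0r max_l// subr_le0.
have x0 : 0 < `|x| := lt_trans ltr01 x1.
rewrite max_r ?subr_ge0 ?(ltW x1)// ger0_norm ?subr_ge0 ?invf_le1 ?(ltW x1)//.
by rewrite mulrBl mul1r mulVf// gt_eqF.
Qed.

Lemma norm_truncate_sqr_le p x : 1 < p <= 2 -> `|truncate x| ^+ 2 <= `|x| `^ p.
Proof.
move=> /andP[p1 p2]; rewrite norm_truncate.
have [x1|x1] := ltP 1 `|x|; last by rewrite sqr_le_powR// normr_ge0.
by rewrite expr1n (le_trans (ltW x1))// le1r_powR// ltW.
Qed.

Lemma norm_sub_truncate_le p x : 1 < p -> `|x - truncate x| <= Kp p * `|x| `^ p.
Proof.
move=> p1; rewrite norm_sub_truncate ge_max sub1_le_Kp// andbT.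
by rewrite mulr_ge0 ?powR_ge0// ltW// Kp_gt0.
Qed.

Lemma truncate_continuous : continuous truncate.
Proof.
have -> : truncate = fun x => (Num.max 1 `|x|)^-1 *: x.
  by apply/funext => x; rewrite /truncate TruncE.
move=> x; apply: cvgZ; last exact: cvg_id.
apply: cvgV; first by rewrite gt_eqF// lt_max ltr01.
apply: (@continuous_max _ _ (fun=> 1) (fun y : B => `|y|)); first exact: cvg_cst.
exact: norm_continuous.
Qed.

End truncation.

Section truncated_step.
Variables (R : realType) (B : normedModType R) (beta p : R) (mu : B).
Hypotheses (beta0 : 0 < beta) (smooth : beta_smooth B beta) (p12 : 1 < p <= 2).
Implicit Types (s x : B) (l : B -> R).

Definition truncated_step x : B := beta^-1 *: (truncate x - mu).

Definition step_const : R := Kp p / beta + exp_rem beta^-1.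

Lemma step_const_ge0 : 0 <= step_const.
Proof.
have /andP[p1 _] := p12.
rewrite addr_ge0//; last by rewrite ltW// exp_rem_gt0 ?invr_gt0.
by rewrite divr_ge0// ltW// Kp_gt0.
Qed.

Lemma truncated_step_continuous : continuous truncated_step.
Proof.
move=> x; apply: cvgZr; apply: cvgB; [exact: truncate_continuous|exact: cvg_cst].
Qed.

Let coshR_norm_truncate s l x : support_functional s l ->
  coshR `|s + beta^-1 *: truncate x| <= coshR `|s| + beta^-1 * sinhR `|s| * l x
    + coshR `|s| * step_const * `|x| `^ p.
Proof.
move=> sl; have [lin _ _] := sl; have /andP[p1 _] := p12.
have bi0 : 0 < beta^-1 by rewrite invr_gt0.
have C0 := coshR_gt0 `|s|.
have norm_incr : `|beta^-1 *: truncate x| = beta^-1 * `|truncate x|.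
  by rewrite normrZ gtr0_norm.
have incr_le : `|beta^-1 *: truncate x| <= beta^-1.
  by rewrite norm_incr ler_piMr ?(ltW bi0)// norm_truncate_le1.
have := coshR_norm_smooth smooth sl bi0 incr_le.
rewrite norm_incr -exprMn mulVKf ?gt_eqF// (cont_linZ lin).
have bias : beta^-1 * sinhR `|s| * (l (truncate x) - l x) <=
    beta^-1 * coshR `|s| * (Kp p * `|x| `^ p).
  apply: (@le_trans _ _ (beta^-1 * sinhR `|s| * `|x - truncate x|)).
    rewrite ler_wpM2l ?mulr_ge0 ?(ltW bi0) ?sinhR_ge0// -(cont_linB lin) distrC.
    by case: sl => _ _; apply.
  apply: ler_pM => //; first by rewrite mulr_ge0 ?(ltW bi0) ?sinhR_ge0.
    by rewrite ler_wpM2l ?(ltW bi0) ?sinhR_le_coshR.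
  exact: norm_sub_truncate_le.
have variance : coshR `|s| * exp_rem beta^-1 * `|truncate x| ^+ 2 <=
    coshR `|s| * exp_rem beta^-1 * `|x| `^ p.
  rewrite ler_wpM2l ?norm_truncate_sqr_le//.
  exact: mulr_ge0 (ltW C0) (ltW (exp_rem_gt0 bi0)).
by rewrite /step_const; lra.
Qed.

(* The centre [mu] is moved into the base point: the convexity of [coshR `|_|]
   pays for the shift, so that only the uncentred [`|x|] enters the error term. *)
Lemma coshR_truncated_step s l x : support_functional (s - beta^-1 *: mu) l ->
  expR (beta^-1 * `|mu|) <= 2 ->
  coshR `|s + truncated_step x| <= coshR `|s|
    + beta^-1 * sinhR `|s - beta^-1 *: mu| * (l x - l mu)
    + 2 * step_const * coshR `|s| * `|x| `^ p.
Proof.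
set s0 := s - _ => sl mu2; have [lin _ _] := sl.
have -> : s + truncated_step x = s0 + beta^-1 *: truncate x.
  by rewrite /truncated_step scalerBr addrCA addrC addrAC.
have := coshR_norm_truncate x sl.
have := coshR_norm_subgradient (beta^-1 *: mu) sl; rewrite subrK (cont_linZ lin).
have base_le : coshR `|s0| <= 2 * coshR `|s|.
  apply: le_trans (coshR_norm_le (e := beta^-1 * `|mu|) (y := s) _) _.
    by rewrite /s0 addrAC subrr add0r normrN normrZ gtr0_norm ?invr_gt0.
  by rewrite ler_wpM2r// ltW// coshR_gt0.
have := ler_wpM2r (mulr_ge0 step_const_ge0 (powR_ge0 `|x| p)) base_le.
lra.
Qed.

End truncated_step.

(** * Borel maps with respect to a sub-sigma-algebra *)

Definition borel_wrt {T : Type} {V : topologicalType} (G : set (set T))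
    (f : T -> V) : Prop :=
  forall U : set V, open U -> G (f @^-1` U).

Lemma separable_dense_seq {R : realType} (B : normedModType R) : separable B ->
  exists e : nat -> B, forall x eps, 0 < eps -> exists n, ball (e n) eps x.
Proof.
move=> [D [/countable_injP[f finj] clD]].
exists (fun n => xget 0 [set x | D x /\ f x = n]) => x eps eps0.
have : closure D x by rewrite clD.
move=> /(_ _ (nbhsx_ballx x eps eps0))[y [Dy /ball_sym xy]]; exists (f y).
by case: xgetP => [z _ [Dz fzy]|/(_ y)[]//]; rewrite (finj z y) ?inE.
Qed.

Section borel_wrt.
Variables (T : pointedType) (G : set (set T)).
Hypothesis sG : sigma_algebra setT G.

Let measurableE : G.-sigma.-measurable = G.
Proof. exact: measurable_g_measurableTypeE. Qed.

Lemma borel_wrt_cst (V : topologicalType) (a : V) : borel_wrt G (fun=> a).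
Proof.
by move=> U _; rewrite -measurableE preimage_cst; case: ifP.
Qed.

Lemma borel_wrt_comp (V W : topologicalType) (h : V -> W) (f : T -> V) :
  continuous h -> borel_wrt G f -> borel_wrt G (h \o f).
Proof. by move=> /continuousP ch Gf U oU; rewrite comp_preimage; exact/Gf/ch. Qed.

Lemma borel_wrt_sub (H : set (set T)) (V : topologicalType) (f : T -> V) :
  G `<=` H -> borel_wrt G f -> borel_wrt H f.
Proof. by move=> GH Gf U /Gf/GH. Qed.

Lemma borel_wrt_closed (V : topologicalType) (f : T -> V) (C : set V) :
  borel_wrt G f -> closed C -> G (f @^-1` C).
Proof.
move=> Gf cC; rewrite -[C]setCK -preimage_setC -setTD.
by case: sG => _ + _; apply; apply: Gf; exact: closed_openC.
Qed.

Lemma borel_wrt_pair (R : realType) (B1 B2 : normedModType R)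
    (f : T -> B1) (g : T -> B2) : separable B1 -> separable B2 ->
  borel_wrt G f -> borel_wrt G g -> borel_wrt G (fun w => (f w, g w)).
Proof.
move=> /separable_dense_seq[e1 dense1] /separable_dense_seq[e2 dense2] Gf Gg U oU.
pose cell (t : nat * nat * nat) : set (B1 * B2) :=
  ball (e1 t.1.1, e2 t.1.2) t.2.+1%:R^-1.
pose fg w := (f w, g w).
have -> : fg @^-1` U =
    \bigcup_t (if `[< cell t `<=` U >] then fg @^-1` cell t else set0).
  apply/seteqP; split=> [w Uw|w [t _]]; last by case: asboolP => // sub /sub.
  have /nbhs_ballP[r /= r0 rU] : nbhs (fg w) U by exact: open_nbhs_nbhs.
  have [k _ /(_ k (leqnn k)) kr] :=
    near_infty_natSinv_lt (PosNum (divr_gt0 r0 (@ltr0Sn R 1))).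
  have k0 : 0 < k.+1%:R^-1 :> R by rewrite invr_gt0.
  have [i fi] := dense1 (f w) _ k0; have [j gj] := dense2 (g w) _ k0.
  have cell_w : cell (i, j, k) (fg w) by split.
  exists (i, j, k) => //; case: asboolP => [//|[z cell_z]]; apply: rU.
  apply: le_ball (ball_triangle (ball_sym cell_w) cell_z).
  by rewrite [r]splitr lerD// ltW.
rewrite -measurableE.
apply: (@countable_bigcupT_measurable _ (g_sigma_algebraType G)) => // t.
case: ifP => // _; apply: (@measurableI _ (g_sigma_algebraType G)).
  by rewrite measurableE; apply: Gf; exact: ball_open.
by rewrite measurableE; apply: Gg; exact: ball_open.
Qed.

Lemma borel_wrtD (R : realType) (B : normedModType R) (f g : T -> B) :
  separable B -> borel_wrt G f -> borel_wrt G g -> borel_wrt G (f \+ g).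
Proof.
move=> sepB Gf Gg.
apply: (@borel_wrt_comp _ _ (fun z : B * B => z.1 + z.2) (fun w => (f w, g w))).
  exact: add_continuous.
exact: borel_wrt_pair.
Qed.

Lemma borel_wrt_shift (R : realType) (B : normedModType R) (s : B) (f : T -> B) :
  borel_wrt G f -> borel_wrt G (fun w => s + f w).
Proof.
apply: (@borel_wrt_comp _ _ (fun x => s + x)) => x.
by apply: cvgD; [exact: cvg_cst|exact: cvg_id].
Qed.

End borel_wrt.

Lemma borel_wrt_measurable {d} {T : measurableType d} {R : realType} (f : T -> R) :
  borel_wrt measurable f -> measurable_fun setT f.
Proof.
move=> mf; apply: (measurability _ (RGenOpens.measurableE R)).
by move=> _ [_ [x [y ->]] <-]; rewrite setTI; apply: mf; exact: interval_open.
Qed.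

Section log_lipschitz.
Variables (R : realType) (B : normedModType R).
Implicit Types (h : B -> R) (x y : B).

Definition log_lipschitz h :=
  (forall x, 0 <= h x) /\ (forall x y, h x <= expR `|x - y| * h y).

Lemma log_lipschitz_continuous h : log_lipschitz h -> continuous h.
Proof.
move=> [_ lip] x.
have cvg_dist : `|x - y| @[y --> x] --> (0 : R).
  rewrite -(normr0 B) -(subrr x); apply: cvg_norm.
  by apply: cvgB; [exact: cvg_cst|exact: cvg_id].
have cvg_exp c : expR (c * `|x - y|) * h x @[y --> x] --> h x.
  rewrite -[X in _ --> X]mul1r -expR0 -(mulr0 c).
  apply: cvgM; last exact: cvg_cst.
  apply: continuous_cvg; first exact: continuous_expR.
  by apply: cvgM; [exact: cvg_cst|].
apply: (squeeze_cvgr _ (cvg_exp (-1)) (cvg_exp 1)); near=> y.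
rewrite mul1r mulN1r expRN ler_pdivrMl ?expR_gt0// lip/=.
by rewrite distrC lip.
Unshelve. all: by end_near. Qed.

Lemma log_lipschitzM h a : 0 <= a -> log_lipschitz h ->
  log_lipschitz (fun x => a * h x).
Proof.
move=> a0 [h0 lip]; split=> [x|x y]; first exact: mulr_ge0.
by rewrite mulrCA ler_wpM2l.
Qed.

Lemma log_lipschitz_measurable d (T : measurableType d) h (f : T -> B) D :
  log_lipschitz h -> borel_wrt measurable f ->
  measurable_fun D (fun w => (h (f w))%:E).
Proof.
move=> /log_lipschitz_continuous ch mf.
apply/measurable_EFinP/measurable_funTS/borel_wrt_measurable.
exact: (borel_wrt_comp ch mf).
Qed.

Lemma log_lipschitz_coshR_norm : log_lipschitz (fun x => coshR `|x|).
Proof.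
by split=> [x|x y]; [rewrite ltW// coshR_gt0|exact: coshR_norm_le].
Qed.

End log_lipschitz.

(** * Supermartingales *)

Section freezing.
Context {d : measure_display} {T : measurableType d} {R : realType}.
Variables (mu : {measure set T -> \bar R}) (B : normedModType R) (G : set (set T)).
Variables (S Y : T -> B) (f g : B -> R).
Hypotheses (sepB : separable B).
Hypotheses (sG : sigma_algebra setT G) (Gm : G `<=` measurable).
Hypotheses (GS : borel_wrt G S) (mY : borel_wrt measurable Y).
Hypotheses (lip_f : log_lipschitz f) (lip_g : log_lipschitz g).
Hypothesis step_le : forall s A, G A ->
  (\int[mu]_(w in A) (f (s + Y w))%:E <= (g s)%:E * mu A)%E.

Let mS : borel_wrt measurable S := borel_wrt_sub Gm GS.

Let measurable_gS A : measurable_fun A (fun w => (g (S w))%:E).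
Proof. exact: log_lipschitz_measurable. Qed.

Let measurable_fSY A : measurable_fun A (fun w => (f (S w + Y w))%:E).
Proof.
apply: log_lipschitz_measurable => //.
by apply: borel_wrtD => //; exact: sigma_algebra_measurable.
Qed.

Lemma integral_frozen_le s eps D : G D -> (forall w, D w -> `|S w - s| <= eps) ->
  (\int[mu]_(w in D) (f (S w + Y w))%:E <=
   (expR (2 * eps))%:E * \int[mu]_(w in D) (g (S w))%:E)%E.
Proof.
move=> GD near_s; have mD := Gm GD; have [[f0 f_le] [g0 g_le]] := (lip_f, lip_g).
have mfs : measurable_fun D (fun w => (f (s + Y w))%:E).
  exact: (log_lipschitz_measurable lip_f (borel_wrt_shift s mY)).
rewrite mulr_natl mulr2n expRD EFinM -muleA.
apply: (@le_trans _ _ ((expR eps)%:E * \int[mu]_(w in D) (f (s + Y w))%:E)%E).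
  rewrite -ge0_integralZl_EFin ?expR_ge0//; last by move=> w _; rewrite lee_fin.
  apply: ge0_le_integral => //; first by move=> w _; rewrite lee_fin.
  - exact: measurable_funeM.
  - move=> w /near_s Sw; rewrite -EFinM lee_fin.
    apply: le_trans (f_le _ (s + Y w)) _.
    by rewrite opprD addrACA subrr addr0 ler_wpM2r// ler_expR.
apply: lee_wpmul2l; first by rewrite lee_fin expR_ge0.
apply: le_trans (step_le s GD) _; rewrite -(integral_cst mu mD).
rewrite -ge0_integralZl_EFin ?expR_ge0//; last by move=> w _; rewrite lee_fin.
apply: ge0_le_integral => //; first by move=> w _; rewrite lee_fin.
- exact: measurable_funeM.
- move=> w /near_s Sw; rewrite -EFinM lee_fin; apply: le_trans (g_le _ (S w)) _.
  by rewrite ler_wpM2r// ler_expR distrC.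
Qed.

(* [S] is frozen at the points of a dense sequence, which makes [step_le]
   applicable on countably many pieces at the cost of a factor close to [1]. *)
Lemma integral_freeze A : G A ->
  (\int[mu]_(w in A) (f (S w + Y w))%:E <= \int[mu]_(w in A) (g (S w))%:E)%E.
Proof.
move=> GA; have [[f0 _] [g0 _]] := (lip_f, lip_g).
have fSY0 w : (0 <= (f (S w + Y w))%:E)%E by rewrite lee_fin.
have gS0 w : (0 <= (g (S w))%:E)%E by rewrite lee_fin.
apply/lee_mul01Pr => [|r /andP[r0 r1]]; first exact: integral_ge0.
pose eps := - ln r / 2.
have eps0 : 0 < eps by rewrite divr_gt0// oppr_gt0 ln_lt0// r0.
have [e dense] := separable_dense_seq sepB.
pose D := seqDU (fun i => A `&` S @^-1` ball (e i) eps).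
have GD i : G (D i).
  rewrite -(measurable_g_measurableTypeE sG).
  apply: seqDU_measurable => {}i; apply: (@measurableI _ (g_sigma_algebraType G)).
    exact: sub_sigma_algebra.
  by apply: sub_sigma_algebra; apply: GS; exact: ball_open.
have mD i : measurable (D i) by exact: Gm.
have near_e i w : D i w -> `|S w - e i| <= eps.
  by case=> -[_ /ball_sym]; rewrite -ball_normE => /ltW.
have AE : A = \bigcup_i D i.
  rewrite -seqDU_bigcup_eq -setI_bigcupr setIidl// => w _.
  by have [i ?] := dense (S w) eps eps0; exists i.
have tD : trivIset setT D by exact: trivIset_seqDU.
rewrite AE ge0_integral_bigcup//.
rewrite [in leRHS]ge0_integral_bigcup//.
rewrite -nneseriesZl; last by move=> i _; exact: integral_ge0.
apply: lee_nneseries => [i _ _|i _].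
  by rewrite mule_ge0// ?lee_fin ?(ltW r0)//; exact: integral_ge0.
have -> : r = (expR (2 * eps))^-1.
  by rewrite /eps mulrC divfK// expRN lnK ?posrE// invrK.
rewrite lee_pdivrMl ?expR_gt0//.
exact: (integral_frozen_le (GD i) (@near_e i)).
Qed.

End freezing.

Section ville.
Context {d : measure_display} {T : measurableType d} {R : realType}.
Variables (mu : {measure set T -> \bar R}).
Variables (F : nat -> set (set T)) (Z : nat -> T -> R).
Implicit Types (c : R) (n : nat) (A : set T).

Definition nonneg_supermartingale :=
  [/\ forall n, borel_wrt (F n) (Z n), forall n w, 0 <= Z n w &
      forall n A, F n A ->
        (\int[mu]_(w in A) (Z n.+1 w)%:E <= \int[mu]_(w in A) (Z n w)%:E)%E].

Lemma markov_split c (f : T -> R) A : 0 <= c -> (forall w, 0 <= f w) ->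
  measurable_fun setT f -> measurable A ->
  (c%:E * mu (A `&` [set w | (c < f w)%R])
   + \int[mu]_(w in A `\` [set w | (c < f w)%R]) (f w)%:E
   <= \int[mu]_(w in A) (f w)%:E)%E.
Proof.
move=> c0 f0 mf mA; set C := [set w | _].
have mC : measurable C.
  have -> : C = setT `&` f @^-1` `]c, +oo[ by rewrite setTI set_itvE.
  exact: mf.
have mAC : measurable (A `&` C) by exact: measurableI.
have mAD : measurable (A `\` C) by exact: measurableD.
have mf' D : measurable_fun D (fun w => (f w)%:E).
  by apply/measurable_EFinP; exact: measurable_funTS.
have f0' w : (0 <= (f w)%:E)%E by rewrite lee_fin.
rewrite -[in leRHS](setUIDK A C) ge0_integral_setU//; last first.
  by apply/disj_setPS => w [[_ Cw] [_]].
rewrite leeD2r// -(integral_cst mu mAC); apply: ge0_le_integral => //.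
by move=> w [_]; rewrite /C/= lee_fin => /ltW.
Qed.

Hypotheses (filtF : filtration F) (superZ : nonneg_supermartingale).

Let crossed c n := \big[setU/set0]_(m < n) [set w | c < Z m w].

Let F_above c n : F n [set w | c < Z n w].
Proof. by have [FZ _ _] := superZ; exact: (FZ n _ (@open_gt R c)). Qed.

Let F_crossed c n : F n (crossed c n.+1).
Proof.
have [sF [_ Fle]] := filtF; rewrite -(measurable_g_measurableTypeE (sF n)).
apply: bigsetU_measurable => m _; apply: sub_sigma_algebra.
by apply: (Fle m n); [rewrite -ltnS|exact: F_above].
Qed.

Let measurable_crossed c n : measurable (crossed c n).
Proof.
have [_ [Fm _]] := filtF.
by case: n => [|n]; [rewrite /crossed big_ord0|exact/Fm/F_crossed].
Qed.

Let measurable_Z n : measurable_fun setT (Z n).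
Proof.
have [_ [Fm _]] := filtF; have [FZ _ _] := superZ.
by apply: borel_wrt_measurable => U /(FZ n)/Fm.
Qed.

Let ville_finite c n : 0 <= c ->
  (c%:E * mu (crossed c n) + \int[mu]_(w in ~` crossed c n) (Z n w)%:E
   <= \int[mu]_w (Z 0 w)%:E)%E.
Proof.
move=> c0; have [_ Z0 stepZ] := superZ; have [sF _] := filtF.
elim: n => [|n]; first by rewrite /crossed big_ord0 measure0 mule0 add0e setC0.
have mC := measurable_crossed c n; apply: le_trans.
have F_notcrossed : F n (~` crossed c n.+1).
  by have [_ FC _] := sF n; rewrite -setTD; exact/FC/F_crossed.
apply: (le_trans (leeD2l _ (stepZ n _ F_notcrossed))).
rewrite /crossed big_ord_recr/= -/(crossed c n) setCU -setDE.
apply: le_trans (leeD2l _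
  (markov_split c0 (Z0 n) (measurable_Z n) (measurableC mC))).
rewrite [leRHS]addeA -ge0_muleDr// leeD2r//; apply: lee_wpmul2l => //.
have -> : crossed c n `|` [set w | c < Z n w] =
    crossed c n `|` (~` crossed c n `&` [set w | c < Z n w]).
  by rewrite setUIr setUCr setTI.
apply: measureU2 => //; apply: measurableI; first exact: measurableC.
by have [_ [Fm _]] := filtF; exact/Fm/F_above.
Qed.

Lemma measurable_exceed c : measurable [set w | exists n, c < Z n w].
Proof.
have [_ [Fm _]] := filtF.
have -> : [set w | exists n, c < Z n w] = \bigcup_n [set w | c < Z n w].
  by apply/seteqP; split=> [w [n cZ]|w [n _ cZ]]; exists n.
by apply: bigcupT_measurable => n; exact/Fm/F_above.
Qed.

Lemma ville c : 0 <= c ->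
  (c%:E * mu [set w | exists n, (c < Z n w)%R] <= \int[mu]_w (Z 0 w)%:E)%E.
Proof.
move=> c0; have [_ Z0 _] := superZ.
have -> : [set w | exists n, c < Z n w] = \bigcup_n crossed c n.+1.
  rewrite (bigcup_bigsetU_bigcup (fun n => [set w | c < Z n w])).
  by apply/seteqP; split=> [w [n cZ]|w [n _ cZ]]; exists n.
have cvg_crossed : (c%:E * mu (crossed c n.+1))%E @[n --> \oo] -->
    (c%:E * mu (\bigcup_n crossed c n.+1))%E.
  apply: cvgeZl => //.
  apply: (@nondecreasing_cvg_mu _ _ _ _ (fun n => crossed c n.+1)) => //.
    exact: bigcupT_measurable.
  move=> m n mn; apply/subsetPset.
  exact: (@subset_bigsetU _ (fun m => [set w | c < Z m w])).
rewrite -(cvg_lim _ cvg_crossed)//; apply: lime_le.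
  by apply/cvg_ex; eexists; exact: cvg_crossed.
apply: nearW => n; apply: le_trans (ville_finite n.+1 c0); rewrite leeDl//.
by apply: integral_ge0 => w _; rewrite lee_fin.
Qed.

End ville.

Lemma nonneg_supermartingale_anytime {d} {T : measurableType d} {R : realType}
    (P : probability T R) (F : nat -> set (set T)) (Z : nat -> T -> R)
    (delta : R) (E : set T) :
  filtration F -> nonneg_supermartingale P F Z ->
  (\int[P]_w (Z 0 w)%:E <= 1)%E -> 0 < delta -> measurable E ->
  (forall w, (forall n, Z n w <= delta^-1) -> E w) -> ((1 - delta)%:E <= P E)%E.
Proof.
move=> filtF superZ Z0_le1 delta0 mE subE.
have mexceed := measurable_exceed filtF superZ delta^-1.
have PE_fin : P E \is a fin_num by exact: fin_num_measure.
rewrite EFinB leeBlDr// addeC -leeBlDr// -probability_setC//.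
apply: (@le_trans _ _ (P [set w | exists n, (delta^-1 < Z n w)%R])).
  apply: le_measure; rewrite ?inE//; first exact: measurableC.
  move=> w nE; apply: contrapT => noexceed; apply: nE; apply: subE => n.
  by rewrite leNgt; apply/negP => Zn; apply: noexceed; exists n.
have := le_trans (ville filtF superZ (ltW (_ : 0 < delta^-1))) Z0_le1.
by rewrite invr_gt0 => /(_ delta0); rewrite lee_pdivrMl// mule1.
Qed.

Section adapted_sum.
Context {d : measure_display} {T : measurableType d} {R : realType}.
Variables (B : normedModType R) (F : nat -> set (set T)) (Y : nat -> T -> B).
Hypotheses (filtF : filtration F) (adaptedY : adapted F Y).

Lemma adapted_comp (V : normedModType R) (h : B -> V) : continuous h ->
  adapted F (fun n w => h (Y n w)).
Proof. by move=> ch n n1; exact: (borel_wrt_comp ch (@adaptedY n n1)). Qed.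

Lemma adapted_measurable n : (1 <= n)%N -> borel_wrt measurable (Y n).
Proof.
by have [_ [Fm _]] := filtF => n1; exact: (borel_wrt_sub (@Fm n)) (@adaptedY n n1).
Qed.

Hypothesis sepB : separable B.

Lemma borel_wrt_sum n : borel_wrt (F n) (fun w => \sum_(1 <= m < n.+1) Y m w).
Proof.
have [sF [_ Fle]] := filtF; elim: n => [|n IH].
  under eq_fun do rewrite big_geq//; exact: borel_wrt_cst.
under eq_fun do rewrite big_nat_recr//=.
by apply: borel_wrtD => //; [exact: borel_wrt_sub (Fle _ _ _) IH|exact: adaptedY].
Qed.

Lemma adapted_sum_supermartingale (mu : {measure set T -> \bar R})
    (f : B -> R) (k : R) :
  log_lipschitz f -> 0 < k ->
  (forall n s A, F n A ->
    (\int[mu]_(w in A) (f (s + Y n.+1 w))%:E <= (k * f s)%:E * mu A)%E) ->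
  nonneg_supermartingale mu F
    (fun n w => (k ^+ n)^-1 * f (\sum_(1 <= m < n.+1) Y m w)).
Proof.
move=> lip_f k0 step_le; have [sF [Fm _]] := filtF.
have kinv_ge0 n : 0 <= (k ^+ n)^-1 by rewrite invr_ge0 exprn_ge0 ?ltW.
split=> [n|n w|n A FA].
- apply: (@borel_wrt_comp _ _ _ _ (fun x => (k ^+ n)^-1 * f x)) (borel_wrt_sum n).
  exact: log_lipschitz_continuous (log_lipschitzM _ lip_f).
- by rewrite mulr_ge0//; case: lip_f.
under eq_integral do rewrite big_nat_recr//=.
apply: (@integral_freeze _ _ _ _ _ (F n) _ _ (fun x => (k ^+ n.+1)^-1 * f x)
  (fun x => (k ^+ n)^-1 * f x)) => //.
- exact: borel_wrt_sum.
- exact: adapted_measurable.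
- exact: log_lipschitzM.
- exact: log_lipschitzM.
- move=> s A' FA'; have mA' := Fm n _ FA'.
  under eq_integral do rewrite EFinM.
  rewrite ge0_integralZl_EFin//; last 2 first.
  + by move=> w _; rewrite lee_fin; case: lip_f.
  + apply: (log_lipschitz_measurable lip_f); apply: borel_wrt_shift.
    exact: adapted_measurable.
  apply: le_trans (lee_wpmul2l _ (step_le n s A' FA')) _; first by rewrite lee_fin.
  by rewrite muleA -EFinM exprSr invfM -mulrA mulKf// gt_eqF.
Qed.

End adapted_sum.

(** * Conditional moments *)

Section conditional_moments.
Context {d : measure_display} {T : measurableType d} {R : realType}.
Variables (P : probability T R) (B : normedModType R) (G : set (set T)).
Implicit Types (X : T -> B) (mu : B) (p v a : R).

Definition cond_mean X mu := forall A, G A ->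
  forall phi : B -> R, cont_lin_functional phi ->
    (\int[P]_(w in A) (phi (X w))%:E = (phi mu)%:E * P A)%E.

Definition cond_moment_le X p v := forall A, G A ->
  (\int[P]_(w in A) (`|X w| `^ p)%:E <= v%:E * P A)%E.

Lemma measurable_norm_powR X p : borel_wrt measurable X ->
  measurable_fun setT (fun w => `|X w| `^ p).
Proof.
move=> mX; apply: (measurableT_comp (measurable_powR p)).
apply: borel_wrt_measurable; exact: (borel_wrt_comp (@norm_continuous _ B) mX).
Qed.

Lemma cond_meanZ X mu a : cond_mean X mu ->
  cond_mean (fun w => a *: X w) (a *: mu).
Proof.
move=> meanX A GA phi lin_phi; rewrite (cont_linZ lin_phi).
under eq_integral do rewrite (cont_linZ lin_phi).
exact: meanX (cont_lin_scale lin_phi a).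
Qed.

Hypotheses (sG : sigma_algebra setT G) (Gm : G `<=` measurable).

Lemma cond_moment_leZ X p v a : 0 <= a -> borel_wrt measurable X ->
  cond_moment_le X p v -> cond_moment_le (fun w => a *: X w) p (a `^ p * v).
Proof.
move=> a0 mX momentX A GA; have mA := Gm GA.
have powE w : `|a *: X w| `^ p = a `^ p * `|X w| `^ p.
  by rewrite normrZ ger0_norm// powRM.
under eq_integral do rewrite powE EFinM.
rewrite ge0_integralZl_EFin ?powR_ge0//; last first.
  exact/measurable_EFinP/measurable_funTS/measurable_norm_powR.
by rewrite EFinM -muleA lee_wpmul2l ?lee_fin ?powR_ge0//; exact: momentX.
Qed.

Variables (X : T -> B) (mu : B) (p v : R).
Hypotheses (mX : borel_wrt measurable X) (p1 : 1 < p).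
Hypotheses (meanX : cond_mean X mu) (momentX : cond_moment_le X p v).

Let G_setT : G setT.
Proof. by case: sG => G0 GC _; rewrite -(setD0 setT); exact: GC. Qed.

Let integrable_norm_powR : P.-integrable setT (fun w => (`|X w| `^ p)%:E).
Proof.
apply/integrableP; split; first exact/measurable_EFinP/measurable_norm_powR.
under eq_integral do rewrite gee0_abs ?lee_fin ?powR_ge0//.
apply: le_lt_trans (momentX G_setT) _.
by rewrite probability_setT mule1 ltry.
Qed.

Let integrable_cont_lin (psi : B -> R) : cont_lin_functional psi ->
  P.-integrable setT (fun w => (psi (X w))%:E).
Proof.
move=> lin_psi; have [K K0 psiK] := cont_lin_bounded lin_psi.
apply: (@le_integrable _ _ _ _ _ _ _
  (fun w => (K%:E * ((cst 1 w)%:E + (`|X w| `^ p)%:E))%E)) => //.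
- apply/measurable_EFinP/borel_wrt_measurable.
  exact: (borel_wrt_comp lin_psi.2 mX).
- move=> w _ /=; rewrite lee_fin [leRHS]ger0_norm ?mulr_ge0 ?addr_ge0 ?powR_ge0//.
  apply: le_trans (psiK _) _; rewrite ler_wpM2l//.
  have [x1|x1] := leP `|X w| 1; first by rewrite (le_trans x1)// lerDl powR_ge0.
  by rewrite (le_trans (le1r_powR (ltW x1) (ltW p1)))// lerDr.
- apply: integrableZl => //; apply: integrableD => //.
  exact: finite_measure_integrable_cst.
Qed.

Lemma integral_affine_majorant_le (f : T -> R) (psi : B -> R) a c A : G A ->
  measurable_fun setT f -> (forall w, 0 <= f w) ->
  cont_lin_functional psi -> 0 <= c ->
  (forall w, f w <= a + (psi (X w) - psi mu) + c * `|X w| `^ p) ->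
  (\int[P]_(w in A) (f w)%:E <= (a + c * v)%:E * P A)%E.
Proof.
move=> GA mf f0 lin_psi c0 f_le; have mA := Gm GA.
have ipsi : P.-integrable A (fun w => (psi (X w))%:E).
  exact: integrableS (integrable_cont_lin lin_psi).
have ipow : P.-integrable A (fun w => (c%:E * (`|X w| `^ p)%:E)%E).
  by apply: integrableZl => //; exact: integrableS integrable_norm_powR.
have icst : P.-integrable A (EFin \o cst (a - psi mu)).
  exact: finite_measure_integrable_cst.
pose h w := ((a - psi mu)%:E + ((psi (X w))%:E + c%:E * (`|X w| `^ p)%:E))%E.
have ih : P.-integrable A h by apply: integrableD => //; exact: integrableD.
apply: (@le_trans _ _ (\int[P]_(w in A) h w)%E).
  apply: ge0_le_integral => //.
  - by move=> w _; rewrite lee_fin.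
  - by apply/measurable_EFinP; exact: measurable_funTS.
  - by case/integrableP: ih.
  - by move=> w _; rewrite /h lee_fin; apply: le_trans (f_le w) _; lra.
rewrite /h integralD//; last exact: integrableD.
rewrite integralD// (meanX GA lin_psi) integralZl//; last first.
  exact: integrableS integrable_norm_powR.
have -> : (\int[P]_(w in A) (a - psi mu)%:E = (a - psi mu)%:E * P A)%E.
  exact: (integral_cst P mA).
have := momentX GA.
have /fineK <- : P A \is a fin_num by exact: fin_num_measure.
rewrite -EFinM => moment_le.
apply: le_trans (leeD2l _ (leeD2l _ (lee_wpmul2l _ moment_le))) _ => //.
by rewrite -!EFinM -!EFinD lee_fin; lra.
Qed.

Lemma norm_mean_powR_le l : support_functional mu l -> `|mu| `^ p <= v.
Proof.
move=> mu_l; have [lin lmu _] := mu_l; have p0 : 0 < p := lt_trans ltr01 p1.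
pose k := p * `|mu| `^ (p - 1); have k0 : 0 <= k by rewrite mulr_ge0 ?powR_ge0 ?ltW.
suff : (\int[P]_(w in setT) (`|mu| `^ p)%:E <= (0 + 1 * v)%:E * P setT)%E.
  have -> : (\int[P]_(w in setT) (`|mu| `^ p)%:E = (`|mu| `^ p)%:E * P setT)%E.
    exact: (integral_cst P).
  by rewrite probability_setT !mule1 lee_fin add0r mul1r.
apply: (@integral_affine_majorant_le _ (fun y => - k * l y)) => //.
  exact: cont_lin_scale.
move=> w; have young := powR_young_tangent p1 (normr_ge0 (X w)) (normr_ge0 mu).
have kmu : k * `|mu| = p * `|mu| `^ p.
  by rewrite /k mulrAC -mulrA mulr_powRB1.
have [_ _ /(_ (X w))/(ler_wpM2l k0)] := mu_l.
rewrite lmu; move: young; rewrite -/k; lra.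
Qed.

Lemma integral_coshR_truncated_step_le beta s A :
  0 < beta -> beta_smooth B beta -> p <= 2 -> expR (beta^-1 * `|mu|) <= 2 -> G A ->
  (\int[P]_(w in A) (coshR `|s + truncated_step beta mu (X w)|)%:E <=
   ((1 + 2 * step_const beta p * v) * coshR `|s|)%:E * P A)%E.
Proof.
move=> beta0 smooth p2 mu2 GA; have p12 : 1 < p <= 2 by rewrite p1.
have [l sl] := exists_support_functional smooth (s - beta^-1 *: mu).
have -> : (1 + 2 * step_const beta p * v) * coshR `|s| =
    coshR `|s| + 2 * step_const beta p * coshR `|s| * v by ring.
apply: (@integral_affine_majorant_le _
  (fun y => beta^-1 * sinhR `|s - beta^-1 *: mu| * l y)) => //.
- apply: borel_wrt_measurable.
  have cosh_cont := log_lipschitz_continuous (@log_lipschitz_coshR_norm R B).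
  apply: (borel_wrt_comp cosh_cont).
  apply: borel_wrt_shift.
  exact: borel_wrt_comp (@truncated_step_continuous _ _ _ _) mX.
- by move=> w; rewrite ltW// coshR_gt0.
- by case: sl => lin _ _; exact: cont_lin_scale.
- exact: mulr_ge0 (mulr_ge0 (ler0n R 2) (step_const_ge0 beta0 p12))
    (ltW (coshR_gt0 _)).
- by move=> w; rewrite -mulrBr; exact: coshR_truncated_step.
Qed.

End conditional_moments.

(** * Deviation of the truncated mean *)

Section bias_const.
Variables (R : realType) (B : normedModType R) (beta p : R).
Hypotheses (beta0 : 0 < beta) (p12 : 1 < p <= 2).

Definition bias_const : R := beta * Cp B beta p + Kp p * 2 `^ (p - 1).

Let p1 : 1 < p. Proof. by case/andP: p12. Qed.

Let exp_rem_2beta_gt0 : 0 < exp_rem (2 / beta).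
Proof. by rewrite exp_rem_gt0// divr_gt0. Qed.

(* The Hilbert value of [Cp] is the smaller one, and suffices in every smooth
   space. *)
Let Cp_ge : 2 `^ (p - 1) * exp_rem (2 / beta) <= Cp B beta p.
Proof.
rewrite /Cp -[X in _ <= _ * X]/(exp_rem (2 / beta)) ler_pM2r//.
by case: ifP => // _; rewrite ler_powR ?ler1n//; lra.
Qed.

Lemma bias_const_ge :
  2 `^ (p - 1) * (beta * exp_rem (2 / beta) + Kp p) <= bias_const.
Proof. by have := ler_wpM2l (ltW beta0) Cp_ge; rewrite /bias_const; lra. Qed.

Lemma bias_const_gt0 : 0 < bias_const.
Proof.
apply: lt_le_trans bias_const_ge; rewrite mulr_gt0 ?powR_gt0//.
by apply: addr_gt0; [exact: mulr_gt0|exact: Kp_gt0].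
Qed.

Lemma beta_step_const_le : beta * step_const beta p <= bias_const.
Proof.
apply: le_trans bias_const_ge.
have -> : beta * step_const beta p = beta * exp_rem beta^-1 + Kp p.
  by rewrite /step_const; field; rewrite gt_eqF.
have pow_ge1 : 1 <= 2 `^ (p - 1).
  by rewrite -[leLHS](powRr0 2) ler_powR ?ler1n// subr_ge0 ltW.
have sum_le : beta * exp_rem beta^-1 + Kp p <= beta * exp_rem (2 / beta) + Kp p.
  rewrite lerD2r ler_wpM2l ?(ltW beta0)// exp_rem_le// invr_gt0 beta0/=.
  by rewrite ler_peMl ?invr_ge0 ?ler1n ?(ltW beta0).
apply: (le_trans sum_le); rewrite ler_peMl// ltW// addr_gt0 ?Kp_gt0//.
exact: mulr_gt0.
Qed.

Lemma powR2D1_le_bias_const : 1 <= beta -> 2 `^ p + 1 <= 2 * bias_const.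
Proof.
move=> b1; have powE : 2 * 2 `^ (p - 1) = 2 `^ p :> R.
  by rewrite mulr_powRB1// (lt_trans ltr01).
have := ler_wpM2l (ler0n R 2) bias_const_ge; rewrite mulrA powE.
have := powR2_Kp_ge1 p1.
have rem_ge : 1 <= beta * exp_rem (2 / beta).
  rewrite -ler_pdivrMl// mulr1; apply: le_trans (exp_rem_ge_div2 _).
    by rewrite mulrAC divff// mul1r.
  by rewrite divr_gt0// ler_pdivrMr// ler_peMr.
have := ler_wpM2l (powR_ge0 2 p) rem_ge; lra.
Qed.

Lemma large_mean_le_bias (b : R) : 1 <= beta -> 0 <= b -> 2 < expR b ->
  1 + b <= 2 * bias_const * b `^ p.
Proof.
move=> beta1 b0 b2; have quad : 1 <= b + b ^+ 2.
  have [b1|/ltW b1] := leP 1 b; first by have := sqr_ge0 b; lra.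
  by have := @expR_le_quadratic R b; rewrite b0 b1 => /(_ isT); lra.
apply: le_trans (ler_wpM2r (powR_ge0 b p) (powR2D1_le_bias_const beta1)).
rewrite mulrDl mul1r -powRM//.
have pow_2b : 2 * b <= (2 * b) `^ p by apply: le1r_powR; [nra|exact: ltW].
have [b1|/ltW b1] := leP 1 b; first by have := le1r_powR b1 (ltW p1); lra.
have : b ^+ 2 <= b `^ p by rewrite sqr_le_powR ?b0 ?b1//; case/andP: p12.
lra.
Qed.

End bias_const.

Lemma ln_2_div_gt0 {R : realType} (delta : R) :
  0 < delta <= 1 -> 0 < ln (2 / delta).
Proof.
by move=> /andP[delta0 delta1]; rewrite ln_gt0// ltr_pdivlMr// mul1r; lra.
Qed.

Section truncated_walk.
Context {d : measure_display} {T : measurableType d} {R : realType}.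
Variables (P : probability T R) (B : normedModType R) (F : nat -> set (set T)).
Variables (X : nat -> T -> B) (mu : B) (beta p v delta : R).
Hypotheses (sepB : separable B) (beta0 : 0 < beta) (smooth : beta_smooth B beta).
Hypotheses (filtF : filtration F) (adaptedX : adapted F X).
Hypothesis meanX : forall n, cond_mean P (F n) (X n.+1) mu.
Hypothesis momentX : forall n, cond_moment_le P (F n) (X n.+1) p v.
Hypotheses (p12 : 1 < p <= 2) (v0 : 0 <= v) (delta01 : 0 < delta <= 1).

Definition truncated_walk n w : B :=
  \sum_(1 <= m < n.+1) truncated_step beta mu (X m w).

Let delta0 : 0 < delta. Proof. by case/andP: delta01. Qed.
Let p1 : 1 < p. Proof. by case/andP: p12. Qed.

Let adapted_step : adapted F (fun n w => truncated_step beta mu (X n w)).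
Proof. by apply: (adapted_comp adaptedX); exact: truncated_step_continuous. Qed.

Lemma borel_truncated_walk n : borel_wrt measurable (truncated_walk n).
Proof.
have [_ [Fm _]] := filtF.
exact: borel_wrt_sub (Fm n) (borel_wrt_sum filtF adapted_step sepB n).
Qed.

Lemma measurable_norm_walk_le n (b : R) :
  measurable [set w | beta * `|truncated_walk n w| <= b].
Proof.
apply: (@borel_wrt_closed _ _ _ _ (fun w => beta * `|truncated_walk n w|)
  [set x | x <= b]); last exact: closed_le.
- exact: sigma_algebra_measurable.
- apply: (@borel_wrt_comp _ _ _ _ (fun x : B => beta * `|x|)) => [x|].
    by apply: cvgM; [exact: cvg_cst|exact: norm_continuous].
  exact: borel_truncated_walk.
Qed.

Let rate := 1 + 2 * step_const beta p * v.

Let rate_gt0 : 0 < rate.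
Proof.
rewrite ltr_pwDl// mulr_ge0// mulr_ge0//; exact: step_const_ge0.
Qed.

Lemma coshR_walk_supermartingale : expR (beta^-1 * `|mu|) <= 2 ->
  nonneg_supermartingale P F
    (fun n w => (rate ^+ n)^-1 * coshR `|truncated_walk n w|).
Proof.
move=> mu2; have [sF [Fm _]] := filtF.
apply: (adapted_sum_supermartingale filtF adapted_step sepB
  (@log_lipschitz_coshR_norm R B) rate_gt0) => n s A FA.
have /andP[_ p2] := p12.
have mX := adapted_measurable filtF adaptedX (ltn0Sn n).
exact: (integral_coshR_truncated_step_le (sF n) (Fm n) mX p1 (@meanX n)).
Qed.

Lemma measurable_norm_walk_all_le (b : nat -> R) :
  measurable [set w | forall n, beta * `|truncated_walk n w| <= b n].
Proof.
rewrite (_ : [set w | _] = \bigcap_n [set w | beta * `|truncated_walk n w| <= b n]).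
  by apply: bigcapT_measurable => n; exact: measurable_norm_walk_le.
by apply/seteqP; split=> w le_b n => [_|]; [exact: le_b|exact: (le_b n I)].
Qed.

Definition walk_bound n : R :=
  2 * v * bias_const B beta p * n%:R + beta * ln (2 / delta).

Lemma norm_walk_le n w :
  (rate ^+ n)^-1 * coshR `|truncated_walk n w| <= delta^-1 ->
  beta * `|truncated_walk n w| <= walk_bound n.
Proof.
rewrite ler_pdivrMl ?exprn_gt0// => cosh_le.
have walk_le : `|truncated_walk n w| <=
    n%:R * (2 * step_const beta p * v) + ln (2 / delta).
  rewrite -ler_expR expRD lnK ?posrE ?divr_gt0//.
  apply: le_trans (expR_le_coshR _) _.
  apply: le_trans (ler_wpM2l (ler0n R 2) cosh_le) _.
  rewrite mulrCA ler_wpM2r ?divr_ge0 ?(ltW delta0)//.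
  by rewrite expRM_natl lerXn2r ?nnegrE ?expR_ge0 ?(ltW rate_gt0)// expR_ge1Dx.
apply: le_trans (ler_wpM2l (ltW beta0) walk_le) _.
rewrite mulrDr lerD2r.
have := ler_wpM2r (mulr_ge0 v0 (ler0n R n)) (beta_step_const_le B beta0 p12); lra.
Qed.

Let norm_mean_le : `|mu| `^ p <= v.
Proof.
have [sF [Fm _]] := filtF; have [l mu_l] := exists_support_functional smooth mu.
have mX := adapted_measurable filtF adaptedX (ltn0Sn 0).
exact: (norm_mean_powR_le (sF 0) (Fm 0) mX p1 (@meanX 0) (@momentX 0) mu_l).
Qed.

Lemma norm_walk_le_large_mean n w : 2 < expR (beta^-1 * `|mu|) ->
  beta * `|truncated_walk n w| <= walk_bound n.
Proof.
move=> mu2; have mu0 : mu != 0.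
  by apply: contraTneq mu2 => ->; rewrite normr0 mulr0 expR0 -leNgt ler1n.
have beta1 := beta_smooth_ge1 smooth (ltW beta0) mu0.
have norm_mu : 1 + `|mu| <= 2 * bias_const B beta p * `|mu| `^ p.
  apply: large_mean_le_bias => //; apply: lt_le_trans mu2 _.
  by rewrite ler_expR ler_piMl// invf_le1.
have norm_step x : beta * `|truncated_step beta mu x| <= 1 + `|mu|.
  rewrite normrZ gtr0_norm ?invr_gt0// mulVKf ?gt_eqF//.
  by apply: le_trans (ler_normB _ _) _; rewrite lerD2r norm_truncate_le1.
apply: (@le_trans _ _ (n%:R * (1 + `|mu|))).
  apply: le_trans (ler_wpM2l (ltW beta0) (ler_norm_sum _ _ _)) _.
  rewrite mulr_sumr; apply: le_trans (ler_sum _ (fun m _ => norm_step (X m w))) _.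
  by rewrite sumr_const_nat subn1 mulr_natl.
have := ler_wpM2l (ler0n R n) norm_mu.
have bias0 := ltW (bias_const_gt0 B beta0 p12).
have := ler_wpM2l (mulr_ge0 (ler0n R n) bias0) norm_mean_le.
have := mulr_gt0 beta0 (ln_2_div_gt0 delta01); rewrite /walk_bound; lra.
Qed.

Lemma truncated_walk_anytime :
  ((1 - delta)%:E <= P [set w | forall n,
    (beta * `|truncated_walk n w| <= walk_bound n)%R])%E.
Proof.
have [mu2|mu2] := leP (expR (beta^-1 * `|mu|)) 2; last first.
  rewrite (_ : [set w | _] = setT) ?probability_setT ?lee_fin ?gerBl ?ltW//.
  by apply/seteqP; split=> // w _ n; exact: norm_walk_le_large_mean.
have superZ := coshR_walk_supermartingale mu2.
apply: (nonneg_supermartingale_anytime filtF superZ) => //.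
- rewrite /truncated_walk.
  under eq_integral do rewrite expr0 invr1 mul1r big_geq// normr0 coshR0.
  have -> : (\int[P]_(w in setT) 1%:E = 1%:E * P setT)%E by exact: (integral_cst P).
  by rewrite mul1e probability_setT.
- exact: measurable_norm_walk_all_le.
- by move=> w Zw n; exact: norm_walk_le.
Qed.

End truncated_walk.

Section truncated_mean.
Context {d : measure_display} {T : measurableType d} {R : realType}.
Variables (P : probability T R) (B : normedModType R) (F : nat -> set (set T)).
Variables (X : nat -> T -> B) (mu : B) (beta p v delta lam : R).
Hypotheses (sepB : separable B) (beta0 : 0 < beta) (smooth : beta_smooth B beta).
Hypotheses (filtF : filtration F) (adaptedX : adapted F X).
Hypothesis meanX : forall n, (1 <= n)%N -> cond_mean P (F n.-1) (X n) mu.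
Hypothesis momentX : forall n, (1 <= n)%N -> cond_moment_le P (F n.-1) (X n) p v.
Hypotheses (p12 : 1 < p <= 2) (v0 : 0 < v) (delta01 : 0 < delta <= 1).
Hypothesis lam0 : 0 < lam.

Let lamX n w := lam *: X n w.

Lemma norm_truncated_walkE n w :
  beta * `|truncated_walk lamX (lam *: mu) beta n w| =
  lam * n%:R * `|mu_hat X lam n w - mu|.
Proof.
have lin : truncated_walk lamX (lam *: mu) beta n w =
    beta^-1 *: (lam *: (n%:R *: (mu_hat X lam n w - mu))).
  rewrite /truncated_walk -scaler_sumr; congr (_ *: _).
  under eq_bigr do rewrite /truncate /lamX scalerA mulrC -scalerA -scalerBr.
  rewrite -scaler_sumr sumrB sumr_const_nat subn1/=; congr (_ *: _).
  have [->|n0] := eqVneq n 0; first by rewrite big_geq// mulr0n subrr scale0r.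
  by rewrite scalerBr scalerA divff ?pnatr_eq0// scale1r scaler_nat.
rewrite lin !normrZ (gtr0_norm lam0) gtr0_norm ?invr_gt0// ger0_norm//.
by rewrite mulVKf ?gt_eqF// mulrA.
Qed.

Let adapted_lamX : adapted F lamX.
Proof. by apply: (adapted_comp adaptedX); exact: scaler_continuous. Qed.

Definition deviation_bound n : R :=
  2 * v * lam `^ (p - 1) * bias_const B beta p
  + beta * ln (2 / delta) / (lam * n%:R).

Let norm_sub_mu_leE n w : (1 <= n)%N ->
  (`|mu_hat X lam n w - mu| <= deviation_bound n) =
  (beta * `|truncated_walk lamX (lam *: mu) beta n w|
    <= walk_bound B beta p (lam `^ p * v) delta n).
Proof.
move=> n1; have n0 : 0 < n%:R :> R by rewrite ltr0n.
have p0 : 0 < p by case/andP: p12 => p1 _; exact: lt_trans p1.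
rewrite norm_truncated_walkE -(ler_pM2l (mulr_gt0 lam0 n0)); congr (_ <= _).
rewrite /walk_bound /deviation_bound -(mulr_powRB1 (ltW lam0) p0).
by field; rewrite !gt_eqF.
Qed.

Let anytime_eventE :
  [set w | forall n : nat, (1 <= n)%N ->
    `|mu_hat X lam n w - mu| <= deviation_bound n] =
  [set w | forall n, beta * `|truncated_walk lamX (lam *: mu) beta n w|
    <= walk_bound B beta p (lam `^ p * v) delta n].
Proof.
apply/seteqP; split=> w bound n => [|n1]; last by rewrite norm_sub_mu_leE.
case: n => [|n]; last by rewrite -norm_sub_mu_leE//; exact: bound.
rewrite norm_truncated_walkE mulr0 mul0r /walk_bound mulr0 add0r.
by rewrite mulr_ge0 ?ltW ?ln_2_div_gt0.
Qed.

Lemma truncated_mean_anytime :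
  ((1 - delta)%:E <= P [set w | forall n : nat, (1 <= n)%N ->
    (`|mu_hat X lam n w - mu| <= deviation_bound n)%R])%E.
Proof.
have [sF [Fm _]] := filtF; rewrite anytime_eventE.
apply: (truncated_walk_anytime sepB beta0 smooth filtF adapted_lamX) => //.
- by move=> n; exact: cond_meanZ (meanX (ltn0Sn n)).
- move=> n; apply: (cond_moment_leZ (Fm n)) (ltW lam0) _ (momentX (ltn0Sn n)).
  exact: (adapted_measurable filtF adaptedX (ltn0Sn n)).
- by rewrite mulr_ge0 ?powR_ge0// ltW.
Qed.

Lemma truncated_mean_fixed_size n : (1 <= n)%N ->
  ((1 - delta)%:E <=
   P [set w | (`|mu_hat X lam n w - mu| <= deviation_bound n)%R])%E.
Proof.
move=> n1; apply: le_trans truncated_mean_anytime _.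
apply: le_measure; rewrite ?inE; last by move=> w; exact.
  rewrite anytime_eventE.
  exact: (measurable_norm_walk_all_le _ _ sepB filtF adapted_lamX).
under eq_set do rewrite norm_sub_mu_leE//.
exact: (measurable_norm_walk_le _ _ sepB filtF adapted_lamX).
Qed.

End truncated_mean.

Lemma optimal_scale {R : realType} (Q C p : R) : 0 < Q -> 0 < C -> 1 < p ->
  let lam := (Q / C) `^ p^-1 in
  C * lam `^ (p - 1) + Q / lam = 2 * C `^ p^-1 * Q `^ ((p - 1) / p).
Proof.
move=> Q0 C0 p1 lam; have p0 : 0 < p := lt_trans ltr01 p1.
have lam0 : 0 < lam by rewrite powR_gt0 ?divr_gt0.
have lam_pow : lam `^ p = Q / C.
  by rewrite /lam -powRrM mulVf ?gt_eqF// powRr1// ltW ?divr_gt0.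
have balance : C * lam `^ (p - 1) = Q / lam.
  apply: (mulfI (lt0r_neq0 lam0)); rewrite mulrCA mulr_powRB1 ?(ltW lam0)// lam_pow.
  by field; rewrite !gt_eqF.
have value : Q / lam = C `^ p^-1 * Q `^ ((p - 1) / p).
  apply: (mulIf (lt0r_neq0 lam0)); rewrite divfK ?gt_eqF//.
  rewrite /lam powRM ?invr_ge0 ?(ltW Q0) ?(ltW C0)//.
  rewrite [Q `^ p^-1 * _]mulrC mulrACA -powRM ?invr_ge0 ?(ltW C0)//.
  rewrite divff ?gt_eqF// powR1 mul1r -powRD; last by rewrite (gt_eqF Q0) implybT.
  rewrite (_ : (p - 1) / p + p^-1 = 1) ?powRr1 ?(ltW Q0)//.
  by field; rewrite gt_eqF.
by rewrite balance value; ring.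
Qed.

Lemma deviation_bound_optimal {R : realType} (B : normedModType R)
    (beta p v delta : R) n :
  0 < beta -> 1 < p <= 2 -> 0 < v -> 0 < delta <= 1 -> (1 <= n)%N ->
  let lam := (ln (2 / delta) * beta /
               (2 * n%:R * v * bias_const B beta p)) `^ p^-1 in
  0 < lam /\
  deviation_bound B beta p v delta lam n =
    2 * (2 * v * bias_const B beta p) `^ p^-1
      * (beta * ln (2 / delta) / n%:R) `^ ((p - 1) / p).
Proof.
move=> beta0 p12 v0 delta01 n1 lam; have /andP[p1 _] := p12.
have n0 : 0 < n%:R :> R by rewrite ltr0n.
have L0 := ln_2_div_gt0 delta01; have bias0 := bias_const_gt0 B beta0 p12.
have Q0 : 0 < beta * ln (2 / delta) / n%:R by rewrite divr_gt0// mulr_gt0.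
have C0 : 0 < 2 * v * bias_const B beta p by rewrite !mulr_gt0.
have lamE : lam =
    ((beta * ln (2 / delta) / n%:R) / (2 * v * bias_const B beta p)) `^ p^-1.
  by rewrite /lam; congr (_ `^ _); field; rewrite !gt_eqF.
have lam0 : 0 < lam by rewrite lamE powR_gt0// divr_gt0.
split=> //; rewrite -(optimal_scale Q0 C0 p1) -lamE /deviation_bound.
by field; rewrite !gt_eqF.
Qed.

Theorem theorem3 (R : realType) (B : completeNormedModType R) (beta : R)
  (d : measure_display) (T : measurableType d) (P : probability T R)
  (F : nat -> set (set T)) (X : nat -> T -> B) (mu : B) (p v delta : R) :
  separable B -> 0 < beta -> beta_smooth B beta ->
  filtration F -> adapted F X ->
  (* E(X_n | F_{n-1}) = mu, via the defining property of conditional expectation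
     tested against all continuous linear functionals *)
  (forall n, (1 <= n)%N -> forall A, F n.-1 A ->
     forall phi : B -> R, cont_lin_functional phi ->
       (\int[P]_(w in A) (phi (X n w))%:E = (phi mu)%:E * P A)%E) ->
  (* E(|X_n|^p | F_{n-1}) <= v, via the defining property *)
  (forall n, (1 <= n)%N -> forall A, F n.-1 A ->
     (\int[P]_(w in A) (`|X n w| `^ p)%:E <= v%:E * P A)%E) ->
  1 < p <= 2 -> 0 < v -> 0 < delta <= 1 ->
  (forall lam : R, 0 < lam ->
     (P [set w | forall n : nat, (1 <= n)%N ->
        (`|mu_hat X lam n w - mu| <=
          2 * v * lam `^ (p - 1) * (beta * Cp B beta p + Kp p * 2 `^ (p - 1))
          + beta * ln (2 / delta) / (lam * n%:R))%R] >= (1 - delta)%:E)%E)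
  /\
  (forall n : nat, (1 <= n)%N ->
     let lam := (ln (2 / delta) * beta /
                  (2 * n%:R * v * (beta * Cp B beta p + Kp p * 2 `^ (p - 1)))) `^ p^-1 in
     (P [set w | (`|mu_hat X lam n w - mu| <=
         2 * (2 * v * (beta * Cp B beta p + Kp p * 2 `^ (p - 1))) `^ p^-1
           * (beta * ln (2 / delta) / n%:R) `^ ((p - 1) / p))%R] >= (1 - delta)%:E)%E).
Proof.
move=> sepB beta0 smooth filtF adaptedX meanX momentX p12 v0 delta01.
split=> [lam lam0|n n1]; cbv zeta.
  exact: (truncated_mean_anytime sepB beta0 smooth filtF adaptedX meanX momentX).
have [lam0 lam_opt] := deviation_bound_optimal B beta0 p12 v0 delta01 n1.
rewrite -/(bias_const B beta p) -lam_opt.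
exact: (truncated_mean_fixed_size sepB beta0 smooth filtF adaptedX meanX momentX).
Qed.
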